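(* Let $n\geq 3$ and let $X=\begin{pmatrix} x_1 & x_2 & \cdots & x_n\\ y_1 & y_2 & \cdots & y_n\end{pmatrix}$ be a $2\times n$ matrix whose entries are (independent commuting) indeterminates. For $1\leq i,j\leq n$ let $\Delta_{ij}=\begin{vmatrix} x_i & x_j\\ y_i & y_j\end{vmatrix}=x_iy_j-x_jy_i$. Let $A=(A_{ij})$ be the symmetric $n\times n$ matrix with $A_{ij}=\Delta_{ij}$ if $i\leq j$ and $A_{ij}=\Delta_{ji}$ if $i>j$. Then $$\det(A)=(-2)^{n-2}\,\Delta_{12}\Delta_{23}\cdots\Delta_{n-1,n}\Delta_{n1}.$$
   Context: Note that $\Delta_{ii}=0$ and $\Delta_{n1}=-\Delta_{1n}$. *)

(* Defs.v *)
From HB Require Import structures.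
From mathcomp Require Import all_boot all_order all_algebra.
From mathcomp Require Import mpoly.

Set Implicit Arguments.
Unset Strict Implicit.
Unset Printing Implicit Defensive.

Import GRing.Theory.
Local Open Scope ring_scope.

(* The 2 * n entries are the distinct variables of {mpoly R[2 * n]}, since
   mxvec_index is a bijection from pairs (i, j) to 'I_(2 * n). *)
Definition generic_mx (R : comNzRingType) (n : nat) :
    'M[{mpoly R[2 * n]}]_(2, n) :=
  \matrix_(i < 2, j < n) 'X_(mxvec_index i j).

Definition Delta (S : comNzRingType) (n : nat) (X : 'M[S]_(2, n))
    (i j : 'I_n) : S :=
  \det (colsub (fun l : 'I_2 => if l == ord0 then i else j) X).

Lemma DeltaE (S : comNzRingType) (n : nat) (X : 'M[S]_(2, n)) (i j : 'I_n) :
  Delta X i j = X 0 i * X 1 j - X 0 j * X 1 i.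
Proof.
rewrite /Delta (expand_det_row _ 0) !big_ord_recl big_ord0 /cofactor !det_mx11.
rewrite !mxE /= expr0 expr1 mul1r mulN1r mulrN addr0.
have -> : lift 0 0 = 1 :> 'I_2 by apply: val_inj.
by [].
Qed.

Definition Delta_sym_mx (S : comNzRingType) (n : nat) (X : 'M[S]_(2, n)) :
    'M[S]_n :=
  \matrix_(i < n, j < n) (if (i <= j)%N then Delta X i j else Delta X j i).

(* Main.v *)
(** The Pluecker relation between columns 1, 2, 3 of [X] gives a combination of
    the first three rows of [A] that is concentrated in column 2. Multiplying
    by the adjugate of [A] yields
      Delta_13 det A = -2 Delta_12 Delta_23 det A',
    where [A'] is the matrix attached to [X] with column 2 deleted. This gives
    the formula by induction once Delta_13 can be cancelled, hence for the
    generic matrix over the integers, and then for every matrix over every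
    commutative ring by specialization. *)
Require Import Defs.
From HB Require Import structures.
From mathcomp Require Import all_boot all_order all_algebra.
From mathcomp Require Import mpoly ring.

Set Implicit Arguments.
Unset Strict Implicit.
Unset Printing Implicit Defensive.

Import GRing.Theory.
Local Open Scope ring_scope.

Lemma Delta_colsub (S : comNzRingType) (n p : nat) (f : 'I_p -> 'I_n)
    (X : 'M[S]_(2, n)) (i j : 'I_p) :
  Delta (colsub f X) i j = Delta X (f i) (f j).
Proof. by rewrite !DeltaE !mxE. Qed.

Lemma Delta_map (S T : comNzRingType) (phi : {rmorphism S -> T}) (n : nat)
    (X : 'M[S]_(2, n)) (i j : 'I_n) :
  Delta (map_mx phi X) i j = phi (Delta X i j).
Proof. by rewrite !DeltaE !mxE rmorphB !rmorphM. Qed.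

Lemma Delta_sym_mx_map (S T : comNzRingType) (phi : {rmorphism S -> T})
    (n : nat) (X : 'M[S]_(2, n)) :
  Delta_sym_mx (map_mx phi X) = map_mx phi (Delta_sym_mx X).
Proof. by apply/matrixP=> i j; rewrite !mxE !Delta_map; case: ifP. Qed.

Lemma Delta_sym_mx_minor (S : comNzRingType) (n : nat) (X : 'M[S]_(2, n))
    (k : 'I_n) :
  row' k (col' k (Delta_sym_mx X)) = Delta_sym_mx (colsub (lift k) X).
Proof.
by apply/matrixP=> i j; rewrite !mxE !Delta_colsub /= leq_bump2.
Qed.

(* The three-term Pluecker relation kills every column but the middle one,
   where the change of sign at the diagonal turns a cancellation into a
   doubling. *)
Lemma Delta_sym_mx_row_relation (S : comNzRingType) (n : nat)
    (X : 'M[S]_(2, n.+3)) (i0 := 0 : 'I_n.+3) (i1 := lift 0 0 : 'I_n.+3)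
    (i2 := lift 0 (lift 0 0) : 'I_n.+3) (A := Delta_sym_mx X) :
  Delta X i1 i2 *: row i0 A - Delta X i0 i2 *: row i1 A
    + Delta X i0 i1 *: row i2 A
  = (2%:R * Delta X i0 i1 * Delta X i1 i2) *: delta_mx 0 i1.
Proof.
apply/rowP=> j; rewrite !mxE eqxx /=.
have [jE|[jE|j2]] : j = i0 \/ j = i1 \/ (2 <= j)%N.
- case: j => [[|[|j]] lt_j] /=.
  + by left; apply: val_inj.
  + by right; left; apply: val_inj.
  + by right; right.
- by rewrite jE /= !DeltaE; ring.
- by rewrite jE eqxx /= !DeltaE; ring.
- have -> : (j == i1) = false by apply/eqP=> ji; rewrite ji in j2.
  by rewrite (ltnW j2) j2 /= !DeltaE; ring.
Qed.

Lemma det_Delta_sym_mx_rec (S : comNzRingType) (n : nat)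
    (X : 'M[S]_(2, n.+3)) (i0 := 0 : 'I_n.+3) (i1 := lift 0 0 : 'I_n.+3)
    (i2 := lift 0 (lift 0 0) : 'I_n.+3) :
  Delta X i0 i2 * \det (Delta_sym_mx X)
  = - 2%:R * Delta X i0 i1 * Delta X i1 i2
    * \det (Delta_sym_mx (colsub (lift i1) X)).
Proof.
(* Since [A *m \adj A] is [\det A] times the identity, entry [i1] keeps only the middle row on the
   left; on the right it reads off the diagonal cofactor at [i1], whose sign is +1. *)
have := congr1 (fun u => (u *m \adj (Delta_sym_mx X)) 0 i1)
  (Delta_sym_mx_row_relation X).
rewrite !mulmxDl mulNmx -!scalemxAl -!row_mul mul_mx_adj -rowE !mxE.
rewrite /cofactor Delta_sym_mx_minor -signr_odd /= expr0 mul1r.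
rewrite !mulr0n !mulr1n !mulr0 add0r addr0 => eqX.
by rewrite -[LHS]opprK eqX -!mulNr.
Qed.

(** Deleting column [i1] replaces the steps [i0] to [i1] to [i2] of the cycle by the single step
    [i0] to [i2]; the other factors agree. *)
Lemma prod_Delta_cycle_rec (S : comNzRingType) (n : nat)
    (X : 'M[S]_(2, n.+3)) (i0 := 0 : 'I_n.+3) (i1 := lift 0 0 : 'I_n.+3)
    (i2 := lift 0 (lift 0 0) : 'I_n.+3) (Y := colsub (lift i1) X) :
  Delta X i0 i2 * \prod_(i < n.+3) Delta X i (ordS i)
  = Delta X i0 i1 * Delta X i1 i2 * \prod_(i < n.+2) Delta Y i (ordS i).
Proof.
rewrite big_ord_recl [in LHS]big_ord_recl [in RHS]big_ord_recl.
rewrite Delta_colsub.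
have -> : ordS ord0 = i1 by apply: val_inj.
have -> : ordS (lift ord0 ord0) = i2 by apply: val_inj.
have -> : lift i1 ord0 = i0 by apply: val_inj.
have -> : lift i1 (ordS ord0) = i2 by apply: val_inj.
have -> : \prod_(i < n.+1) Delta Y (lift ord0 i) (ordS (lift ord0 i))
  = \prod_(i < n.+1) Delta X (lift ord0 (lift ord0 i))
                            (ordS (lift ord0 (lift ord0 i))).
  apply: eq_bigr => i _; rewrite Delta_colsub; congr (Delta X _ _).
    exact: val_inj.
  apply: val_inj; rewrite /= /bump /=.
  (* At the last index both successors wrap around to 0, which [lift i1] fixes. *)
  have:= ltn_ord i; rewrite ltnS leq_eqVlt => /orP[/eqP -> | lt_in].
    by rewrite !add1n !modnn.
  by rewrite !add1n !modn_small.
rewrite -/i0 -/i1 -/i2; ring.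
Qed.

(** The induction starts at two columns, where both sides are the negated square of the only minor.
    The nonvanishing hypothesis is inherited when a column is deleted. *)
Lemma det_Delta_sym_mx_idomain (S : idomainType) (n : nat)
    (X : 'M[S]_(2, n.+2)) :
  (forall i j, i != j -> Delta X i j != 0) ->
  \det (Delta_sym_mx X) =
    (- 2%:R) ^+ n * \prod_(i < n.+2) Delta X i (ordS i).
Proof.
elim: n X => [|n IHn] X X_neq0.
  rewrite (expand_det_row _ 0) !big_ord_recl !big_ord0 /cofactor !det_mx11.
  rewrite !mxE /= !DeltaE.
  have -> : ordS ord0 = lift 0 0 :> 'I_2 by apply: val_inj.
  have -> : ordS (lift ord0 ord0) = 0 :> 'I_2 by apply: val_inj.
  have -> : lift (lift 0 0) 0 = 0 :> 'I_2 by apply: val_inj.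
  by rewrite /=; ring.
have Dneq0 : Delta X 0 (lift 0 (lift 0 0)) != 0 by apply: X_neq0.
apply: (mulfI Dneq0); rewrite det_Delta_sym_mx_rec IHn => [|i j neq_ij].
  by rewrite [RHS]mulrCA prod_Delta_cycle_rec exprS; ring.
by rewrite Delta_colsub X_neq0 // (inj_eq (@lift_inj _ _)).
Qed.

Lemma generic_mx_specialize (S : comNzRingType) (n : nat)
    (X : 'M[S]_(2, n)) :
  map_mx (mmap intr (fun k => mxvec X 0 k)) (generic_mx int n) = X.
Proof.
by apply/matrixP=> i j; rewrite !mxE mmapX mmap1U mxvecE.
Qed.

Lemma Delta_generic_neq0 (n : nat) (i j : 'I_n) :
  i != j -> Delta (generic_mx int n) i j != 0.
Proof.
move=> neq_ij.
(* Columns [i] and [j] specialize to the standard basis, so the polynomial takes the value 1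
   there. *)
pose X : 'M[int]_(2, n) := \matrix_(r, c) (c == if r == 0 then i else j)%:R.
have X1 : Delta X i j = 1.
  by rewrite DeltaE !mxE /= !eqxx (eq_sym j) (negPf neq_ij) mulr1 mul0r subr0.
apply/eqP=> D0; have /eqP := X1.
by rewrite -(generic_mx_specialize X) Delta_map D0 rmorph0 eq_sym oner_eq0.
Qed.

Lemma det_Delta_sym_mx (S : comNzRingType) (n : nat) (X : 'M[S]_(2, n.+2)) :
  \det (Delta_sym_mx X) =
    (- 2%:R) ^+ n * \prod_(i < n.+2) Delta X i (ordS i).
Proof.
(* [S] may have zero divisors, but integer polynomials form a domain. *)
rewrite -(generic_mx_specialize X) Delta_sym_mx_map det_map_mx.
rewrite (det_Delta_sym_mx_idomain (@Delta_generic_neq0 _)).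
rewrite rmorphM rmorphXn rmorphN rmorph_nat rmorph_prod.
by congr (_ * _); apply: eq_bigr => i _; rewrite Delta_map.
Qed.

(* ordS i is the cyclic successor of i : 'I_n, so the last factor of the
   product is Delta_{n1}. *)
Theorem theorem1p1 (R : comNzRingType) (n : nat) (hn : (3 <= n)%N) :
  let X := generic_mx R n in
  \det (Delta_sym_mx X) =
    (- 2%:R) ^+ (n - 2) * \prod_(i < n) Delta X i (ordS i).
Proof.
move=> X; rewrite {}/X; case: n hn => [|[|n]] // _.
by rewrite !subSS subn0 det_Delta_sym_mx.
Qed.
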